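(* Suppose that: (i) for each $(\pi,V)\in\mathbb{S}\times\mathbb{R}^d$ there exists a unique Nash minimizer $P(\pi,V)$ of $e(\pi,\cdot,V)$; (ii) for each $1\le i\le d$, $e_i:\mathbb{S}\times\mathbb{S}^d\times\mathbb{R}^d\to\mathbb{R}$ is continuous; (iii) there exists $C$ such that $|\mathcal{G}_\pi(V)_i-\mathcal{G}_\pi(V)_{i'}|\le C$ for any $(\pi,V)\in\mathbb{S}\times\mathbb{R}^d$ and all indices $i,i'$. Then there exist a pair of vectors $(\bar\pi,\bar V)\in\mathbb{S}\times\mathbb{R}^d$, a constant $\bar\lambda\in\mathbb{R}$ and a transition matrix $\bar P$, namely the Nash minimizer $\bar P=P(\bar\pi,\bar V)$, such that for all $i$ $$\mathcal{G}_{\bar\pi}(\bar V)_i=\sum_j\left(c_{ij}(\bar\pi,\bar P)\bar P_{ij}+\bar V_j\bar P_{ij}\right)=\bar V_i+\bar\lambda,$$ and $\bar\pi=\bar\pi\bar P$.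
   Context: Let $d>1$ be an integer and $\mathbb{S}=\{(q_1,\dots,q_d): q_j\ge 0\ \forall j,\ \sum_{j=1}^d q_j=1\}$. The set of $d\times d$ (row-)stochastic (transition) matrices is identified with $\mathbb{S}^d$. Given transition costs $c_{ij}(\pi,P)$, $1\le i,j\le d$ (functions of $\pi\in\mathbb{S}$, $P\in\mathbb{S}^d$), define $e_i(\pi,P,V)=\sum_j \left(c_{ij}(\pi,P)P_{ij}+V_jP_{ij}\right)$ for $V\in\mathbb{R}^d$. For $P\in\mathbb{S}^d$, $q\in\mathbb{S}$, $\mathcal{P}(P,q,i)$ is the stochastic matrix obtained from $P$ by replacing its $i$-th row by $q$. A matrix $P\in\mathbb{S}^d$ is a Nash minimizer of $e(\pi,\cdot,V)$ if for each $i$ and any $q\in\mathbb{S}$, $e_i(\pi,P,V)\le e_i(\pi,\mathcal{P}(P,q,i),V)$. When a unique Nash minimizer $P(\pi,V)$ exists for all $(\pi,V)$, define $\mathcal{G}_\pi(V)_i=e_i(\pi,P(\pi,V),V)$. *)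

(* Defs.v *)
From HB Require Import structures.
From mathcomp Require Import all_boot all_order all_algebra.
From mathcomp Require Import all_classical all_reals all_analysis.

Set Implicit Arguments.
Unset Strict Implicit.
Unset Printing Implicit Defensive.

Import Order.TTheory GRing.Theory Num.Theory.
Import numFieldNormedType.Exports.

Local Open Scope classical_set_scope.
Local Open Scope ring_scope.

Definition simplex (R : realType) (d : nat) : set 'rV[R]_d :=
  [set q | (forall j, 0 <= q ord0 j) /\ \sum_(j < d) q ord0 j = 1].

Definition stochastic (R : realType) (d : nat) : set 'M[R]_d :=
  [set P | forall i, simplex (row i P)].

(* Costs are total functions; only their values on [simplex] and [stochastic]
   are ever constrained or used. *)
Definition costs (R : realType) (d : nat) : Type :=
  'I_d -> 'I_d -> 'rV[R]_d -> 'M[R]_d -> R.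

Definition expected_cost (R : realType) (d : nat) (c : costs R d) (i : 'I_d)
    (pi : 'rV[R]_d) (P : 'M[R]_d) (V : 'rV[R]_d) : R :=
  \sum_(j < d) (c i j pi P * P i j + V ord0 j * P i j).

Definition replace_row (R : realType) (d : nat) (P : 'M[R]_d) (q : 'rV[R]_d)
    (i : 'I_d) : 'M[R]_d :=
  \matrix_(k, j) (if k == i then q ord0 j else P k j).

Definition Nash_minimizer (R : realType) (d : nat) (c : costs R d)
    (pi V : 'rV[R]_d) : set 'M[R]_d :=
  [set P | stochastic P /\
    forall (i : 'I_d) (q : 'rV[R]_d), simplex q ->
      expected_cost c i pi P V <= expected_cost c i pi (replace_row P q i) V].

(* Junk value 0 when there is no Nash minimizer; an arbitrary one is chosen
   when there are several. *)
Definition the_Nash_minimizer (R : realType) (d : nat) (c : costs R d)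
    (pi V : 'rV[R]_d) : 'M[R]_d :=
  xget 0 (Nash_minimizer c pi V).

Definition Nash_value (R : realType) (d : nat) (c : costs R d)
    (pi V : 'rV[R]_d) (i : 'I_d) : R :=
  expected_cost c i pi (the_Nash_minimizer c pi V) V.

(* Main.v *)
(* A fixed point of (pi, V) |-> (pi P(pi, V), G_pi(V) - mean of G_pi(V)), up to
   an additive constant in V, solves the problem: the mean of G is then lambda up
   to that constant.  The map is continuous because the Nash minimizers have a
   closed graph, compact range and are unique, and assumption (iii) confines its
   second component to a compact set, so Brouwer's theorem applies.

   Brouwer's theorem on the simplex is deduced from Scarf's combinatorial lemma:
   colour each grid point x by some i with x_i <= f(x)_i.  Scarf's lemma, applied
   to the orders given by the coordinates, yields a small set of grid points
   using every colour i except some for which x_i is nearly 0; at a limit point z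
   one gets z_i <= f(z)_i for all i, hence z = f(z) since both sum to 1. *)
Require Import Defs.
From HB Require Import structures.
From mathcomp Require Import all_boot all_order zify.

Set Implicit Arguments.
Unset Strict Implicit.
Unset Printing Implicit Defensive.

(** * Scarf's lemma *)

(** With one more element in [X] than in [Y], exactly one fibre of [f] has two elements and the
    others are singletons; deleting a point keeps the image full only if it lies in the double
    fibre. This pigeonhole produces both the two rooms of a door and the two doors of a room. *)
Lemma imset_surj_card_succ (A B : finType) (f : A -> B) (X : {set A}) (Y : {set B}) :
  f @: X = Y -> #|X| = #|Y|.+1 ->
  exists a b : A, [/\ a \in X, b \in X, a != b, f a = f b &
    {in X, forall i, (f @: (X :\ i) == Y) = (i == a) || (i == b)}].
Proof.
move=> fX cX.
have ninj : ~~ [forall a in X, forall b in X, (f a == f b) ==> (a == b)].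
  apply/negP => /forall_inP h.
  suff /card_in_imset : {in X &, injective f} by rewrite fX cX; lia.
  move=> a b aX bX /eqP fab; apply/eqP.
  by move/forall_inP : (h a aX) => /(_ b bX) /implyP; apply.
have [a [b [aX bX ab fab]]] :
    exists a b : A, [/\ a \in X, b \in X, a != b & f a = f b].
  move: ninj; rewrite negb_forall_in => /exists_inP[a aX].
  rewrite negb_forall_in => /exists_inP[b bX]; rewrite negb_imply => /andP[/eqP fab ab].
  by exists a, b.
exists a, b; split => // i iX.
have del x y : x \in X -> y \in X -> x != y -> f x = f y -> f @: (X :\ x) = Y.
  move=> xX yX xy fxy; apply/setP => z; apply/imsetP/idP => [[t + ->]|].
    by rewrite in_setD1 -fX => /andP[_ tX]; apply: imset_f.
  rewrite -fX => /imsetP[t tX ->]; have [->|tx] := eqVneq t x.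
    by exists y; rewrite // in_setD1 eq_sym xy.
  by exists t; rewrite // in_setD1 tx.
apply/eqP/orP => [fXi|[/eqP->|/eqP->]]; last 2 first.
- exact: (del a b).
- by apply: (del b a); rewrite // eq_sym.
apply/orP; apply: contraT; rewrite negb_or => /andP[ia ib].
have inj : {in X :\ i &, injective f}.
  by apply/imset_injP; rewrite fXi; move: (cardsD1 i X); rewrite iX cX; lia.
have := inj a b; rewrite !in_setD1 aX bX !(eq_sym _ i) ia ib => /(_ isT isT fab).
by move/eqP: ab.
Qed.

Section Scarf.
Variables (T I : finType) (r : I -> T -> nat).
Hypothesis r_inj : forall i, injective (r i).
Implicit Types (s : {set T}) (C : {set I}) (R D : {set T} * {set I}).

(* [r i] ranks [T] for the [i]-th linear order.  Every door [(s, C)] with [s]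
   nonempty is in exactly two rooms, and every room which is not colourful has an
   even number of doors that miss only the colour [i0]; the only such door with
   [s] empty is in a single room, so some room is colourful. *)
Definition dominant R :=
  [forall y, exists i in R.2, forall x in R.1, r i y <= r i x].
Definition room R := dominant R && (#|R.1| == #|R.2|).
Definition door D := dominant D && (#|D.1|.+1 == #|D.2|).
Definition door_of D R := (D.1 \subset R.1) && (R.2 \subset D.2).

Lemma dominantP s C :
  reflect (forall y, exists2 i, i \in C & {in s, forall x, r i y <= r i x})
          (dominant (s, C)).
Proof.
apply: (iffP forallP) => h y.
  by case/exists_inP: (h y) => i iC /forall_inP; exists i.
by case: (h y) => i iC hi; apply/exists_inP; exists i => //; apply/forall_inP.
Qed.

Lemma dominant_door_of D R : door_of D R -> dominant R -> dominant D.
Proof.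
case: D R => [t D] [s C] /andP[/= /subsetP ts /subsetP CD] /dominantP h.
by apply/dominantP => y; case: (h y) => i /CD iD hi; exists i => // x /ts; apply: hi.
Qed.

(** The inclusions give [#|D.1| <= #|R.1| = #|R.2| <= #|D.1|.+1], so exactly one of them is strict,
    and by a single element. *)
Lemma door_ofP D R : door D -> room R -> door_of D R ->
  (R.1 = D.1 /\ exists2 i, i \in D.2 & R.2 = D.2 :\ i) \/
  (R.2 = D.2 /\ exists2 x, x \notin D.1 & R.1 = x |: D.1).
Proof.
case: D R => [t D] [s C] /andP[_ /= /eqP cD] /andP[_ /= /eqP cR] /andP[/= ts CD].
have := subset_leq_card ts; have := subset_leq_card CD => lCD lts.
have [ets|nts] := eqVneq #|t| #|s|.
  left; have est : s = t by apply/esym/eqP; rewrite eqEcard ts ets leqnn.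
  split=> //; have : 0 < #|D :\: C| by rewrite cardsD (setIidPr CD); lia.
  case/card_gt0P => i; rewrite inE => /andP[iC iD]; exists i => //.
  apply/eqP; rewrite eqEcard subsetD1 CD iC /=.
  by have := cardsD1 i D; rewrite iD; lia.
right; have eCD : C = D by apply/eqP; rewrite eqEcard CD; lia.
split=> //; have : 0 < #|s :\: t| by rewrite cardsD (setIidPr ts); lia.
case/card_gt0P => x; rewrite inE => /andP[xt xs]; exists x => //.
apply/esym/eqP; rewrite eqEcard subUset sub1set xs ts /= cardsU1 xt.
by rewrite add1n cR eCD -cD.
Qed.

(** The only such room pairs [i] with the maximum of [r i], which exists because [x0] makes [T]
    nonempty. *)
Lemma empty_door_rooms (x0 : T) i :
  #|[set R | room R & door_of (set0, [set i]) R]| = 1.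
Proof.
have [x _ xmax] := arg_maxnP (r i) (isT : predT x0).
apply/eqP/cards1P; exists ([set x], [set i]); apply/setP => R; rewrite !inE.
apply/andP/eqP => [[rR]|->]; last first.
  split; last by rewrite /door_of sub0set /=.
  rewrite /room !cards1 eqxx andbT; apply/dominantP => y.
  by exists i; rewrite ?set11 // => z /set1P ->; apply: xmax.
move=> dR; have dd : door (set0, [set i]).
  by rewrite /door (dominant_door_of dR) ?cards0 ?cards1 //; case/andP: rR.
case: (door_ofP dd rR dR) => /=; case: R rR dR => s C /= /andP[/dominantP dom _] _.
  case=> _ [j /set1P -> eC]; have [k] := dom x0.
  by rewrite eC setDv inE.
case=> eC [y _]; rewrite setU0 => es; rewrite eC es in dom *.
have [k /set1P -> /(_ y (set11 y)) xy] := dom x.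
congr (_, _); congr [set _]; apply: (r_inj (i := i)); apply/eqP.
by rewrite eqn_leq xy andbT; exact: (xmax y isT).
Qed.

(** Sending each index of [D] to the minimum of [t] in its order maps [D] onto [t], so two indices
    [a] and [b] share a minimum; each of them gives one way to complete the door to a room. *)
Lemma nonempty_door_rooms (t : {set T}) (D : {set I}) : door (t, D) -> t != set0 ->
  #|[set R | room R & door_of (t, D) R]| = 2.
Proof.
move=> dd /set0Pn[x0 x0t].
pose m i := [arg min_(x < x0 in t) r i x].
have mt i : m i \in t by rewrite /m; case: arg_minnP.
have mmin i x : x \in t -> r i (m i) <= r i x.
  by move: x; rewrite /m; case: arg_minnP.
have /andP[/dominantP dom /= /eqP cD] := dd.
have mD : m @: D = t.
  apply/setP => x; apply/imsetP/idP => [[i _ ->]//|xt].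
  have [i iD xmin] := dom x; exists i => //; apply: (r_inj (i := i)); apply/eqP.
  by rewrite eqn_leq mmin // xmin.
have [a [b [aD bD ab mab mdel]]] := imset_surj_card_succ mD (esym cD).
(* The points that dominate [t] for every index of [D] other than [k]. *)
pose M k := [set y | [forall j in D :\ k, r j (m j) < r j y]].
have MP k y : reflect {in D :\ k, forall j, r j (m j) < r j y} (y \in M k).
  by rewrite inE; apply: forall_inP.
(* The room obtained from [k]: drop [k] if [M k] is empty, otherwise keep [D] and add the point of
   [M k] that is largest in the order [k]. *)
pose R_ k := if [pick y in M k] is Some y
  then ([arg max_(z > y in M k) r k z] |: t, D) else (t, D :\ k).
have R_P k : (M k = set0 /\ R_ k = (t, D :\ k)) \/
   exists2 y, (y \in M k) /\ {in M k, forall z, r k z <= r k y} & R_ k = (y |: t, D).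
  rewrite /R_; case: pickP => [y yM|M0].
    by right; case: arg_maxnP => // z zM zmax; exists z.
  by left; split=> //; apply/setP => z; rewrite M0 inE.
have Mle k y : k \in D -> y \in M k -> r k y <= r k (m k).
  move=> kD /MP yM; have [j jD jy] := dom y.
  have := jy _ (mt j); have [->//|jk] := eqVneq j k.
  by rewrite leqNgt yM // !inE jk.
have Mnt k y : k \in D -> m @: (D :\ k) = t -> y \in M k -> y \notin t.
  move=> kD mk /MP yM; apply/negP; rewrite -mk => /imsetP[j jD yj].
  by have := yM j jD; rewrite yj ltnn.
have R_room k : k \in D -> m @: (D :\ k) = t ->
    room (R_ k) && door_of (t, D) (R_ k).
  move=> kD mk; case: (R_P k) => [[M0 ->]|[y [yM ymax] ->]].
    rewrite /door_of /= subxx subsetDl /room /= andbT.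
    apply/andP; split; last by have := cardsD1 k D; rewrite kD -cD => -[->].
    apply/dominantP => y; have : y \notin M k by rewrite M0 inE.
    rewrite inE negb_forall_in => /exists_inP[j jD]; rewrite -leqNgt => yj.
    by exists j => // x xt; apply: leq_trans yj _; apply: mmin.
  rewrite /door_of /= subxx subsetUr /room /= cardsU1 (Mnt k) // add1n cD eqxx !andbT.
  apply/dominantP => z.
  have [zM|] := boolP (z \in M k).
    exists k => // x /setU1P[->|xt]; first exact: ymax.
    exact: leq_trans (Mle k z kD zM) (mmin k x xt).
  rewrite inE negb_forall_in => /exists_inP[j jD]; rewrite -leqNgt => zj.
  exists j; first by case/setD1P: jD.
  move=> x /setU1P[->|xt]; last exact: leq_trans zj (mmin j x xt).
  by apply: leq_trans zj _; apply: ltnW; move/MP: yM; apply.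
have mDab k : k \in D -> (k == a) || (k == b) -> m @: (D :\ k) = t.
  by move=> kD kab; apply/eqP; rewrite mdel.
have room_R s C : room (s, C) -> door_of (t, D) (s, C) ->
    exists k, [/\ k \in D, m @: (D :\ k) = t & (s, C) = R_ k].
  move=> rR dR; case: (door_ofP dd rR dR) (rR) => /= [[-> [k kD ->]]|[-> [x xt ->]]];
    case/andP=> /dominantP domR _.
    exists k; split=> //.
      apply/setP => x; apply/imsetP/idP => [[i _ ->]//|xt].
      have [i iD xmin] := domR x; exists i => //; apply: (r_inj (i := i)).
      by apply/eqP; rewrite eqn_leq mmin // xmin.
    case: (R_P k) => [[_ ->]//|[y [/MP yM _] _]].
    by have [j jD /(_ _ (mt j))] := domR y; rewrite leqNgt yM.
  (* Dominance at the added point [x] itself finds the index [k] in which [x] is lowest; every point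
     of [t] is then the minimum for some other index. *)
  have [k kD xmin] := domR x.
  exists k; have tk z : z \in t -> exists2 j, j \in D & z = m j /\ r j z < r j x.
    move=> zt; have [j jD zmin] := domR z; exists j => //; split.
      apply: (r_inj (i := j)); apply/eqP.
      by rewrite eqn_leq mmin // zmin // !inE mt orbT.
    rewrite ltn_neqAle zmin ?setU11 // andbT; apply: contraNneq xt => /r_inj <-.
    exact: zt.
  have xk z : z \in t -> r k x <= r k z by move=> zt; apply: xmin; rewrite inE zt orbT.
  have mk : m @: (D :\ k) = t.
    apply/setP => z; apply/imsetP/idP => [[i _ ->]//|zt].
    have [j jD [zj jx]] := tk z zt; exists j => //.
    rewrite !inE jD andbT; apply: contraTneq jx => ->.
    by rewrite -leqNgt xk.
  have xM : x \in M k.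
    (* Otherwise [D] without [k] and [j], which has one element fewer than [t], would still map onto
       [t]. *)
    apply/MP => j jDk; rewrite ltnNge; apply/negP => xj.
    have : t \subset m @: (D :\ k :\ j).
      apply/subsetP => z zt; have [l lD [zl lx]] := tk z zt.
      apply/imsetP; exists l => //; rewrite !inE lD andbT.
      apply/andP; split; apply: contraTneq lx => ->; rewrite -leqNgt.
        exact: leq_trans xj (mmin j z zt).
      exact: xk.
    move/subset_leq_card; have := leq_imset_card m (D :\ k :\ j).
    have := cardsD1 k D; have := cardsD1 j (D :\ k); rewrite jDk kD; lia.
  split=> //; case: (R_P k) => [[M0 _]|[y [yM ymax] ->]].
    by rewrite M0 inE in xM.
  congr (_ |: _, _); apply: (r_inj (i := k)); apply/eqP; rewrite eqn_leq ymax //=.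
  have [j jD yj] := domR y.
  have [<-|jk] := eqVneq j k; first by rewrite yj ?setU11.
  have := yj (m j); rewrite !inE mt orbT leqNgt => /(_ isT).
  by move/MP: yM => -> //; rewrite !inE jk.
suff -> : [set R | room R & door_of (t, D) R] = [set R_ a; R_ b].
  rewrite cards2; suff -> : R_ a != R_ b by [].
  have nt y k : y \in M k -> k \in [set a; b] -> (y |: t == t) = false.
    move=> yM; rewrite !inE => kab; have kD : k \in D by case/orP: kab => /eqP ->.
    apply/negbTE; apply: contra (Mnt k y kD (mDab k kD kab) yM) => /eqP <-.
    exact: setU11.
  have := R_P a; have := R_P b.
  case=> [[_ ->]|[z [zM _] ->]]; case=> [[_ ->]|[y [yM _] ->]]; rewrite xpair_eqE.
  - by rewrite eqxx; apply/eqP => /setP/(_ a); rewrite !inE eqxx aD ab.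
  - by rewrite (nt y a) // !inE eqxx.
  - by rewrite eq_sym (nt z b) // !inE eqxx orbT.
  (* If both rooms added the same point [y], it would lie above [m a] in the order [a] as a member
     of [M b], which [Mle] forbids for a member of [M a]. *)
  have ma : m @: (D :\ a) = t by apply: mDab; rewrite ?eqxx.
  rewrite eqxx andbT; apply/eqP => /setP/(_ y).
  rewrite !in_setU1 eqxx (negPf (Mnt a y aD ma yM)) /= => /esym.
  rewrite orbF => /eqP yz.
  have /MP/(_ a) := zM; rewrite !inE ab aD -yz => /(_ isT).
  by rewrite ltnNge (Mle a y).
apply/setP => -[s C]; rewrite in_set2 inE; apply/andP/orP.
  case=> rR dR; have [k [kD mk ->]] := room_R s C rR dR.
  by have /eqP := mk; rewrite mdel // => /orP[]/eqP ->; rewrite eqxx; [left|right].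
case=> /eqP ->; apply/andP; apply: R_room => //; apply: mDab => //.
  by rewrite eqxx.
by rewrite eqxx orbT.
Qed.

Variable col : T -> I.

Definition almost_colorful i0 D := (i0 \in D.2) && (col @: D.1 == D.2 :\ i0).

(** The number is 0 or 2. If such a door exists, [s] uses every colour of [C] except [i0]. Either
    two points share a colour and removing either one gives a door, or one point has a colour
    outside [C] and the doors come from removing it or from adding its colour to [C]. *)
Lemma almost_colorful_doors_even i0 R : room R -> col @: R.1 != R.2 ->
  ~~ odd #|[set D | [&& door D, almost_colorful i0 D & door_of D R]]|.
Proof.
case: R => s C rR /= sC; set X := [set _ | _].
have [->|/set0Pn[D0]] := eqVneq X set0; first by rewrite cards0.
rewrite inE => /and3P[dD0 /andP[iD0 /eqP colD0] D0R].
have /andP[domR /= /eqP cR] := rR.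
have doorI (t : {set T}) (D : {set I}) : door_of (t, D) (s, C) -> #|t|.+1 == #|D| -> door (t, D).
  by move=> h cD; rewrite /door cD (dominant_door_of h).
have [iC icol subC] : [/\ i0 \in C, i0 \notin col @: s & C :\ i0 \subset col @: s].
  case: (door_ofP dD0 rR D0R) sC => /= [[-> [i iD ->]]|[-> [x xD ->]]].
    rewrite colD0 => ne; have ii0 : i0 != i by apply: contraNneq ne => ->.
    rewrite !inE eqxx ii0 iD0; split=> //.
    by apply/subsetP => j; rewrite !inE => /and3P[-> _ ->].
  rewrite imsetU1 colD0 => ne; rewrite !inE eqxx iD0 orbF; split=> //.
    by apply: contraNneq ne => <-; rewrite setD1K.
  exact: subsetUr.
have cC := cardsD1 i0 C; rewrite iC in cC.
have [colE|colNE] := eqVneq (col @: s) (C :\ i0).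
  have [] := imset_surj_card_succ colE; first by rewrite cR.
  move=> a [b [aS bS ab _ hab]].
  suff -> : X = [set (s :\ a, C); (s :\ b, C)].
    rewrite cards2 xpair_eqE eqxx andbT; suff -> : s :\ a != s :\ b by [].
    by apply/eqP => /setP/(_ a); rewrite !inE eqxx ab aS.
  have inX k : k \in s -> (k == a) || (k == b) -> (s :\ k, C) \in X.
    move=> ks kab; have dk : door_of (s :\ k, C) (s, C).
      by rewrite /door_of /= subsetDl subxx.
    rewrite inE dk /almost_colorful /= iC hab // kab doorI //=.
    by have := cardsD1 k s; rewrite ks cR => ->.
  apply/setP => -[t D]; rewrite in_set2; apply/idP/orP; last first.
    by case=> /eqP ->; apply: inX => //; rewrite eqxx ?orbT.
  rewrite inE => /and3P[dD /andP[/= iD /eqP colD] DR].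
  case: (door_ofP dD rR DR) => /= [[ts [i]]|[CD [x xt st]]].
    move=> jD CE; move: colE; rewrite ts colD CE => /setP/(_ i).
    rewrite !inE jD eqxx /= andbF andbT => /negbFE/eqP ii0.
    by move: iC; rewrite CE ii0 !inE eqxx.
  have ets : t = s :\ x by rewrite st setU1K.
  have : col @: (s :\ x) == C :\ i0 by rewrite -ets colD CD.
  rewrite hab; last by rewrite st setU11.
  by rewrite ets CD => /orP[]/eqP ->; [left|right].
(* Second case: the extra colour [i1] makes [col] injective on [s] by counting, so a single point
   [x] carries it. *)
have : 0 < #|col @: s :\: (C :\ i0)|.
  rewrite card_gt0; apply: contra colNE; rewrite setD_eq0 => h.
  by rewrite eqEsubset h.
case/card_gt0P => i1; rewrite inE => /andP[i1C /imsetP[x xs i1x]].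
have colE : col @: s = i1 |: (C :\ i0).
  apply/esym/eqP; rewrite eqEcard subUset sub1set i1x imset_f // subC cardsU1 -i1x i1C.
  by rewrite -cC -cR leq_imset_card.
have col_inj : {in s &, injective col}.
  by apply/imset_injP; rewrite colE cardsU1 i1C -cC cR.
have colDx : col @: (s :\ x) = C :\ i0.
  apply/setP => j; apply/imsetP/idP => [[y]|jC].
    rewrite in_setD1 => /andP[yx ys] ->.
    have : col y \in col @: s by apply: imset_f.
    rewrite colE in_setU1 => /orP[|//]; rewrite i1x => /eqP/col_inj => /(_ ys xs) yx'.
    by rewrite yx' eqxx in yx.
  have /imsetP[y ys jy] : j \in col @: s by apply: (subsetP subC).
  exists y => //; rewrite in_setD1 ys andbT; apply: contraNneq i1C => yx.
  by rewrite i1x -yx -jy.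
suff -> : X = [set (s, i0 |: col @: s); (s :\ x, C)].
  rewrite cards2 xpair_eqE; suff -> : s == s :\ x = false by [].
  by apply/eqP => /setP/(_ x); rewrite !inE eqxx xs.
apply/setP => -[t D]; rewrite in_set2; apply/idP/orP; last first.
  case=> /eqP [-> ->]; rewrite inE.
    have h : door_of (s, i0 |: col @: s) (s, C).
      by rewrite /door_of /= subxx -(setD1K iC) setUS.
    rewrite h /almost_colorful /= setU11 setU1K // eqxx doorI //.
    by rewrite cardsU1 icol add1n (card_in_imset col_inj).
  have h : door_of (s :\ x, C) (s, C) by rewrite /door_of /= subsetDl subxx.
  rewrite h /almost_colorful /= iC colDx eqxx doorI //.
  by have := cardsD1 x s; rewrite xs cR => ->.
rewrite inE => /and3P[dD /andP[/= iD /eqP colD] DR].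
case: (door_ofP dD rR DR) => /= [[ts _]|[CD [y yt st]]].
  by left; rewrite ts colD setD1K.
right; have xt : x \notin t.
  by apply: contra i1C => xt; rewrite CD -colD i1x imset_f.
have yx : x = y by apply/eqP; move: xs; rewrite st !inE (negPf xt) orbF.
by rewrite st yx setU1K // CD.
Qed.

Theorem scarf (x0 : T) (i0 : I) : exists2 R, room R & col @: R.1 = R.2.
Proof.
have [/exists_inP[R rR /eqP]|] := boolP [exists R in room, col @: R.1 == R.2].
  by exists R.
rewrite negb_exists_in => /forall_inP ncol; exfalso.
pose typed D := door D && almost_colorful i0 D.
have : \sum_(R | room R) #|[set D | typed D & door_of D R]|
     = \sum_(D | typed D) #|[set R | room R & door_of D R]|.
  under eq_bigr do rewrite -sum1dep_card.
  under [RHS]eq_bigr do rewrite -sum1dep_card.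
  rewrite (exchange_big_dep typed) /=; last by move=> ? ? _ /andP[].
  apply: eq_bigr => D tD; apply: eq_bigl => R; by rewrite tD.
have t0 : typed (set0, [set i0]).
  rewrite /typed /door /almost_colorful /= cards0 cards1 eqxx set11 imset0 setDv eqxx !andbT.
  by apply/dominantP => y; exists i0; rewrite ?set11 // => z; rewrite inE.
(* Counted by doors, the incidences number 1 for the empty door plus 2 for each other typed door, an
   odd total. *)
rewrite [RHS](bigD1 (set0, [set i0])) //= (empty_door_rooms x0).
rewrite [X in 1 + X](eq_bigr (fun=> 2)); last first.
  move=> [t D] /=; rewrite xpair_eqE => /andP[/andP[dD /andP[/= iD /eqP colD]] nD].
  apply: nonempty_door_rooms => //; apply: contra nD => /eqP t0'.
  by rewrite t0' eqxx /= -(setD1K iD) -colD t0' imset0 setU0.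
rewrite sum_nat_const => /(congr1 odd).
rewrite oddD oddM andbF /=.
rewrite (big_morph odd oddD (erefl : odd 0 = false)) big1 // => R rR.
apply/negbTE; have := almost_colorful_doors_even i0 rR (ncol R rR).
by rewrite /typed; congr (~~ odd _); apply: eq_card => D; rewrite !inE andbA.
Qed.

End Scarf.

(** * Scarf's lemma on the integral grid of the simplex *)

Section Grid.
Variables (I : finType) (N : nat).

(* The points [x / N] of the standard simplex with [x] integral. *)
Definition grid := {x : {ffun I -> 'I_N.+1} | \sum_i x i == N}.
Implicit Types x y z : grid.

Definition gcoord x i : nat := val x i.

(** Scarf's lemma requires strict orders, so ties between equal coordinates are broken by an
    enumeration of the grid. *)
Definition gcoord_rank i x := gcoord x i * #|{: grid}| + enum_rank x.

Lemma gcoord_rank_inj i : injective (gcoord_rank i).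
Proof.
move=> x y /(congr1 (modn^~ #|{: grid}|)).
by rewrite /gcoord_rank !modnMDl !modn_small // => /val_inj/enum_rank_inj.
Qed.

Lemma gcoord_rank_le i x y : gcoord_rank i x <= gcoord_rank i y -> gcoord x i <= gcoord y i.
Proof.
move/(leq_div2r #|{: grid}|); rewrite /gcoord_rank.
have g0 : 0 < #|{: grid}| by apply/card_gt0P; exists x.
by rewrite !divnMDl // !divn_small // !addn0.
Qed.

Lemma sum_gcoord x : \sum_i gcoord x i = N.
Proof. exact/eqP/(valP x). Qed.

Lemma grid_above (i0 : I) (a : I -> nat) : \sum_i a i <= N ->
  exists x, forall i, a i <= gcoord x i.
Proof.
move=> aN; pose b i := a i + (i == i0) * (N - \sum_i a i).
have sb : \sum_i b i = N.
  rewrite big_split /= -big_distrl /= [X in _ + X * _](bigD1 i0) //=.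
  rewrite [X in _ + (_ + X) * _]big1 => [|i /negPf->//].
  by rewrite eqxx addn0 mul1n subnKC.
have bN i : b i < N.+1 by rewrite ltnS -sb (bigD1 i) //= leq_addr.
pose x := [ffun i => Ordinal (bN i)].
have xP : \sum_i x i == N.
  by apply/eqP; rewrite -[RHS]sb; apply: eq_bigr => i _; rewrite ffunE.
exists (exist (fun x : {ffun I -> 'I_N.+1} => \sum_i x i == N) x xP) => i.
by rewrite /gcoord /= ffunE /=; apply: leq_addr.
Qed.

(** In a colourful room [(s, C)] all points of [s] are within [#|I|] of one another in every
    coordinate. A colour in [C] is attained on [s]; an index outside [C] has its coordinate at most
    [#|I|] there. *)
Lemma grid_coloring (i0 : I) (col : grid -> I) :
  exists x, forall i, gcoord x i <= #|I| \/
    exists2 y, col y = i & forall j,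
      gcoord x j <= gcoord y j + #|I| /\ gcoord y j <= gcoord x j + #|I|.
Proof.
have [x0 _] : exists x, forall i, 0 <= gcoord x i.
  by apply: (@grid_above i0 (fun=> 0)); rewrite big1.
have [[s C] /andP[/= /dominantP dom /eqP cR] colsC] := scarf gcoord_rank_inj col x0 i0.
have [x xs] : exists x, x \in s.
  by apply/card_gt0P; rewrite /= in cR; rewrite cR; apply/card_gt0P; case: (dom x0) => i; exists i.
rewrite /= in colsC.
pose m i := [arg min_(y < x in s) gcoord y i].
have ms i : m i \in s by rewrite /m; case: arg_minnP.
have mmin i y : y \in s -> gcoord (m i) i <= gcoord y i.
  by move: y; rewrite /m; case: arg_minnP.
(* The coordinatewise minimum over [s], replaced by 0 off [C]. *)
pose a i := (i \in C) * gcoord (m i) i.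
have als y i : y \in s -> a i <= gcoord y i.
  by rewrite /a; case: (i \in C); rewrite ?mul1n //; apply: mmin.
(* If [a] had more than [#|I|] units to spare, some grid point would exceed [a] strictly in every
   coordinate, against dominance. *)
have suma : N <= \sum_i a i + #|I|.
  rewrite leqNgt; apply/negP => lt.
  have [|z za] := @grid_above i0 (fun i => a i + 1).
    by rewrite big_split /= sum1_card; apply: ltnW lt.
  have [i iC /(_ _ (ms i))/gcoord_rank_le] := dom z.
  by rewrite leqNgt => /negP[]; have := za i; rewrite /a iC mul1n addn1.
(* The coordinates of [y] sum to [N] and are all at least those of [a], so no single one can exceed
   its bound by more than the total slack. *)
have close y i : y \in s -> gcoord y i <= a i + #|I|.
  move=> ys; have := sum_gcoord y; have := suma.
  rewrite (bigD1 i) //= [X in X = N -> _](bigD1 i) //=.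
  have : \sum_(j | j != i) a j <= \sum_(j | j != i) gcoord y j.
    by apply: leq_sum => j _; apply: als.
  lia.
exists x => i; have [iC|iC] := boolP (i \in C); last first.
  by left; have := close x i xs; rewrite /a (negPf iC).
right; move: iC; rewrite -colsC => /imsetP[y ys ->]; exists y => // j.
by split; [apply: leq_trans (close x j xs) _ | apply: leq_trans (close y j ys) _];
  rewrite leq_add2r als.
Qed.

End Grid.

(** * Brouwer's fixed point theorem *)

From mathcomp Require Import all_algebra.
From mathcomp Require Import all_classical all_reals all_analysis.
From mathcomp Require Import ring lra.

Import Order.TTheory GRing.Theory Num.Theory.
Import numFieldNormedType.Exports.

Local Open Scope classical_set_scope.
Local Open Scope ring_scope.

(** * Limits of matrices along filters; closedness of the simplex *)

Section Convergence.
Variable R : realType.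

Lemma cvg_mx m n (T : Type) (F : set_system T) (u : T -> 'M[R]_(m, n))
    (M : 'M[R]_(m, n)) :
  Filter F -> (forall i j, u t i j @[t --> F] --> M i j) -> u @ F --> M.
Proof.
move=> FF uM A [P MP PA]; rewrite /= nbhs_simpl.
have : \forall t \near F, forall i j, P i j (u t i j).
  by apply: filter_forall => i; apply: filter_forall => j; apply: uM.
by apply: filterS => t ut; apply: PA.
Qed.

Lemma cvg_entry m n (T : Type) (F : set_system T) (u : T -> 'M[R]_(m, n))
    (M : 'M[R]_(m, n)) i j :
  u @ F --> M -> u t i j @[t --> F] --> M i j.
Proof. by move=> uM; exact: (cvg_comp _ _ uM (@coord_continuous R m n i j M)). Qed.

Lemma cvg_sumr (T : Type) (F : set_system T) (I : finType) (u : I -> T -> R) l :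
  Filter F -> (forall i, u i @ F --> l i) ->
  \sum_i u i t @[t --> F] --> \sum_i l i.
Proof. by move=> FF ul; apply: cvg_big => //; apply: add_continuous. Qed.

Lemma ultra_fmap (T U : Type) (F : set_system T) (u : T -> U) :
  UltraFilter F -> UltraFilter (u @ F).
Proof.
move=> FU; split; first exact: fmap_proper_filter.
move=> G GP FG; apply/seteqP; split => // A GA.
have [//|FnA] := in_ultra_setVsetC (u @^-1` A) FU.
have : G (A `&` ~` A) by apply: filterI => //; apply: FG.
by rewrite setICr => /filter_not_empty.
Qed.

(** Each entry converges by compactness of the segment; refining to an ultrafilter thus replaces the
    extraction of convergent subsequences. *)
Lemma ultra_mx_cvg m n (T : Type) (F : set_system T) (u : T -> 'M[R]_(m, n)) a b :
  UltraFilter F -> (\forall t \near F, forall i j, a <= u t i j <= b) ->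
  exists M : 'M[R]_(m, n), u @ F --> M.
Proof.
move=> FU uab.
have lim_ij (ij : 'I_m * 'I_n) : exists l : R, u t ij.1 ij.2 @[t --> F] --> l.
  have := @segment_compact R a b; rewrite compact_ultra => /(_ (u t ij.1 ij.2 @[t --> F])).
  case; [exact: ultra_fmap| |by move=> l [_ ul]; exists l].
  by apply: filterS uab => t /(_ ij.1 ij.2); rewrite /= in_itv.
have [l ul] := choice lim_ij.
by exists (\matrix_(i, j) l (i, j)); apply: cvg_mx => i j; rewrite mxE; apply: (ul (i, j)).
Qed.

Lemma simplex_le1 n (q : 'rV[R]_n) i : simplex q -> q ord0 i <= 1.
Proof. by case=> q0 <-; rewrite (bigD1 i) //= lerDl sumr_ge0. Qed.

Lemma stochastic_ge0 n (P : 'M[R]_n) i j : stochastic P -> 0 <= P i j.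
Proof. by move=> /(_ i)[/(_ j)]; rewrite mxE. Qed.

Lemma stochastic_le1 n (P : 'M[R]_n) i j : stochastic P -> P i j <= 1.
Proof. by move=> /(_ i)/(@simplex_le1 _ _ j); rewrite mxE. Qed.

Lemma stochastic_sum n (P : 'M[R]_n) i : stochastic P -> \sum_j P i j = 1.
Proof. by move=> /(_ i)[_ <-]; apply: eq_bigr => j _; rewrite mxE. Qed.

Lemma cvg_simplex n (T : topologicalType) (F : set_system T) (u : T -> 'rV[R]_n) q :
  ProperFilter F -> (\forall t \near F, simplex (u t)) -> u @ F --> (q : 'rV[R]_n) -> simplex q.
Proof.
move=> FF us uq; split=> [j|].
  apply: (ler_cvg_to (cvg_cst 0) (@cvg_entry _ _ _ _ _ _ ord0 j uq)).
  by apply: filterS us => t [].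
have su := cvg_sumr _ (fun j => @cvg_entry _ _ _ _ _ _ ord0 j uq).
apply: (closed_cvg _ (@closed_eq R 1) _ _ (su _)).
by apply: filterS us => t [].
Qed.

Lemma cvg_row m n (T : Type) (F : set_system T) (u : T -> 'M[R]_(m, n))
    (M : 'M[R]_(m, n)) i :
  Filter F -> u @ F --> M -> row i (u t) @[t --> F] --> row i M.
Proof.
move=> FF uM; apply: cvg_mx => k j; rewrite mxE.
by under eq_fun do rewrite mxE; apply: cvg_entry.
Qed.

Lemma cvg_stochastic n (T : topologicalType) (F : set_system T) (u : T -> 'M[R]_n) P :
  ProperFilter F -> (\forall t \near F, stochastic (u t)) ->
  u @ F --> (P : 'M[R]_n) -> stochastic P.
Proof.
move=> FF us uP i; apply: (cvg_simplex FF _ (cvg_row (i := i) _ uP)).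
by apply: filterS us => t; apply.
Qed.

End Convergence.

(** * From approximate to exact fixed points on the simplex *)

Section Brouwer.
Variables (R : realType) (n : nat) (f : 'rV[R]_n -> 'rV[R]_n).
Hypothesis fS : forall x, simplex x -> simplex (f x).

Lemma simplex_le_eq (x y : 'rV[R]_n) : simplex x -> simplex y ->
  (forall i, x ord0 i <= y ord0 i) -> x = y.
Proof.
move=> [_ x1] [_ y1] xy; apply/rowP => i; apply/eqP; rewrite -subr_eq0 -oppr_eq0 opprB.
have ge0 j : true -> 0 <= y ord0 j - x ord0 j by rewrite subr_ge0.
by apply/eqP; apply: (psumr_eq0P ge0) => //; rewrite sumrB x1 y1 subrr.
Qed.

Lemma brouwer_approx (i0 : 'I_n) (N : nat) (e := n%:R / N.+1%:R : R) :
  exists x, simplex x /\ forall i, exists y,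
    [/\ simplex y, forall j, `|x ord0 j - y ord0 j| <= e
      & y ord0 i <= f y ord0 i + e].
Proof.
pose pt (x : grid 'I_n N.+1) : 'rV[R]_n := \row_j ((gcoord x j)%:R / N.+1%:R).
have N0 : 0 < N.+1%:R :> R by rewrite ltr0n.
have ptS x : simplex (pt x).
  split=> [j|]; first by rewrite mxE divr_ge0.
  under eq_bigr do rewrite mxE.
  by rewrite -mulr_suml -natr_sum sum_gcoord divff // gt_eqF.
(* Both points sum to 1, so some [i] always qualifies and the default [i0] is never reached. *)
pose col x := odflt i0 [pick i | pt x ord0 i <= f (pt x) ord0 i].
have colP x : pt x ord0 (col x) <= f (pt x) ord0 (col x).
  rewrite /col; case: pickP => //= h; exfalso.
  have : \sum_i f (pt x) ord0 i < \sum_i pt x ord0 i.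
    apply: ltr_sum => [|i _]; last by rewrite ltNge h.
    by apply/hasP; exists i0; rewrite ?mem_index_enum.
  by have [_ ->] := fS (ptS x); have [_ ->] := ptS x; rewrite ltxx.
have [x xP] := grid_coloring i0 col.
exists (pt x); split => // i; case: (xP i) => [xi|[y yi xy]].
  (* A coordinate of at most [e] needs no coloured neighbour: the point itself works because [f] has
     nonnegative values there. *)
  exists (pt x); split => // [j|]; first by rewrite subrr normr0 divr_ge0.
  apply: ler_wpDl; first by have [] := fS (ptS x).
  by rewrite mxE ler_pM2r ?invr_gt0 // ler_nat -[leqRHS]card_ord.
exists (pt y); split => // [j|].
  have [] := xy j; rewrite card_ord => xyj yxj.
  rewrite !mxE -mulrBl normrM (ger0_norm (x := _^-1)) ?invr_ge0 //.
  rewrite ler_pM2r ?invr_gt0 // ler_norml lerNl opprB !lerBlDr -!natrD !ler_nat.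
  by rewrite ![(n + _)%N]addnC yxj xyj.
by rewrite -yi; apply: le_trans (colP y) _; rewrite lerDl divr_ge0.
Qed.

Theorem brouwer_simplex (i0 : 'I_n) :
  {within @simplex R n, continuous f} -> exists2 x, simplex x & f x = x.
Proof.
move=> /subspace_continuousP fc.
pose e N : R := n%:R / N.+1%:R.
have e0 : e @ \oo --> (0 : R).
  by rewrite -[X in _ --> X](mulr0 n%:R); apply: cvgM (cvg_cst _) cvg_harmonic.
have [X XP] := choice (brouwer_approx i0).
have [Y YP] : exists Y : nat * 'I_n -> 'rV[R]_n, forall Ni, [/\ simplex (Y Ni),
    forall j, `|X Ni.1 ord0 j - Y Ni ord0 j| <= e Ni.1
    & Y Ni ord0 Ni.2 <= f (Y Ni) ord0 Ni.2 + e Ni.1].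
  have [Y YP] := choice (fun Ni : nat * 'I_n => (XP Ni.1).2 Ni.2).
  by exists Y.
have [G [GU oG]] := ultraFilterLemma eventually_filter.
have [z Xz] : exists z : 'rV[R]_n, X @ G --> z.
  apply: (@ultra_mx_cvg R _ _ _ _ X 0 1); near=> N => i j.
  by have [[X0 X1] _] := XP N; rewrite (ord1 i) X0 simplex_le1.
have zS : simplex z.
  by apply: cvg_simplex Xz; near=> N; have [] := XP N.
exists z => //; apply/esym/simplex_le_eq => // [|i]; first exact: fS.
have eG : e @ G --> (0 : R) by apply: cvg_trans e0; apply: cvg_app.
(* For every [i] the witnesses have the same limit as [X], so the single point [z] inherits all the
   inequalities. *)
have Yz : Y (N, i) @[N --> G] --> z.
  apply: cvg_mx => k j; rewrite (ord1 k).
  have Xzj : X N ord0 j @[N --> G] --> z ord0 j := cvg_entry Xz.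
  have lo : X N ord0 j - e N @[N --> G] --> z ord0 j.
    by rewrite -[X in _ --> X]subr0; apply: cvgB.
  have hi : X N ord0 j + e N @[N --> G] --> z ord0 j.
    by rewrite -[X in _ --> X]addr0; apply: cvgD.
  apply: squeeze_cvgr lo hi; near=> N.
  have [_ /(_ j) /= + _] := YP (N, i).
  by rewrite ler_distlC.
have fYz : f (Y (N, i)) @[N --> G] --> f z.
  move=> A /(fc z zS)/Yz; rewrite /= !nbhs_simpl /=.
  by apply: filterS => N; apply; have [] := YP (N, i).
have Yzi : Y (N, i) ord0 i @[N --> G] --> z ord0 i := cvg_entry Yz.
have fYzi : f (Y (N, i)) ord0 i + e N @[N --> G] --> f z ord0 i.
  by rewrite -[X in _ --> X]addr0; apply: cvgD => //; apply: cvg_entry.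
apply: ler_cvg_to Yzi fYzi _; near=> N.
by have [] := YP (N, i).
Unshelve. all: by end_near.
Qed.

End Brouwer.

Lemma simplex_mulmx (R : realType) (d : nat) (q : 'rV[R]_d) (P : 'M[R]_d) :
  simplex q -> stochastic P -> simplex (q *m P).
Proof.
move=> [q0 q1] PS; split=> [j|].
  by rewrite mxE sumr_ge0 // => i _; rewrite mulr_ge0 // stochastic_ge0.
under eq_bigr do rewrite mxE.
rewrite exchange_big /= -[RHS]q1; apply: eq_bigr => i _.
by rewrite -mulr_sumr stochastic_sum // mulr1.
Qed.

(** * Continuity of the Nash minimizer *)

Section NashContinuity.
Variables (R : realType) (d : nat) (c : costs R d).
Hypothesis hNash : forall pi V : 'rV[R]_d, simplex pi ->
  exists! P : 'M[R]_d, Nash_minimizer c pi V P.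
Hypothesis hcont : forall i : 'I_d,
  {within (@simplex R d `*` @stochastic R d) `*` [set: 'rV[R]_d],
    continuous (fun x : 'rV[R]_d * 'M[R]_d * 'rV[R]_d =>
                  expected_cost c i x.1.1 x.1.2 x.2)}.

Lemma the_Nash_minimizerP pi V :
  simplex pi -> Nash_minimizer c pi V (the_Nash_minimizer c pi V).
Proof. by move=> /(hNash V)[P [NP _]]; apply: xgetPex; exists P. Qed.

Lemma Nash_minimizer_uniq pi V P : simplex pi -> Nash_minimizer c pi V P ->
  P = the_Nash_minimizer c pi V.
Proof.
move=> piS NP; have [Q [_ uQ]] := hNash V piS.
by rewrite -(uQ P NP); apply: uQ; apply: the_Nash_minimizerP.
Qed.

Lemma stochastic_replace_row (P : 'M[R]_d) q i :
  stochastic P -> simplex q -> stochastic (replace_row P q i).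
Proof.
move=> PS qS k; have [->|ki] := eqVneq k i.
  by rewrite (_ : row _ _ = q) //; apply/rowP => j; rewrite !mxE eqxx.
rewrite (_ : row _ _ = row k P) //; apply/rowP => j.
by rewrite !mxE (negPf ki).
Qed.

Section Limit.
Variables (T : topologicalType) (F : set_system T) (pi V : T -> 'rV[R]_d).
Variables (pi' V' : 'rV[R]_d).
Context {FF : ProperFilter F}.
Hypotheses (piS : \forall t \near F, simplex (pi t)) (piS' : simplex pi').
Hypotheses (cpi : pi @ F --> pi') (cV : V @ F --> V').

(** Relative continuity on the domain, put in filter form: the limit stays in the domain because
    stochastic matrices are closed. *)
Lemma cvg_expected_cost (P : T -> 'M[R]_d) (P' : 'M[R]_d) i :
  (\forall t \near F, stochastic (P t)) -> P @ F --> P' ->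
  expected_cost c i (pi t) (P t) (V t) @[t --> F] --> expected_cost c i pi' P' V'.
Proof.
move=> PS cP; have P'S : stochastic P' := cvg_stochastic FF PS cP.
have := (subspace_continuousP _ _).1 (@hcont i) (pi', P', V').
move=> /(_ (conj (conj piS' P'S) I)) h A /h /=; rewrite nbhs_simpl /= => hA.
have cT : (pi t, P t, V t) @[t --> F] --> (pi', P', V').
  exact: (cvg_pair (cvg_pair cpi cP) cV).
have := cT _ hA; rewrite /= !nbhs_simpl /= => hA'.
by apply: filterS3 piS PS hA' => t piSt PSt; apply.
Qed.

(** The closed graph: for a fixed deviation [q], replacing a row is continuous in the matrix, so
    both sides of the Nash inequality converge. *)
Lemma cvg_Nash_minimizer (P : T -> 'M[R]_d) (P' : 'M[R]_d) :
  (\forall t \near F, Nash_minimizer c (pi t) (V t) (P t)) -> P @ F --> P' ->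
  Nash_minimizer c pi' V' P'.
Proof.
move=> NP cP.
have PS : \forall t \near F, stochastic (P t) by apply: filterS NP => t [].
split; first exact: cvg_stochastic FF PS cP.
move=> i q qS.
have cQ : replace_row (P t) q i @[t --> F] --> replace_row P' q i.
  apply: cvg_mx => k j; rewrite mxE.
  under eq_fun do rewrite mxE.
  by case: (k == i); [apply: cvg_cst | apply: cvg_entry].
have QS : \forall t \near F, stochastic (replace_row (P t) q i).
  by apply: filterS PS => t PSt; exact: stochastic_replace_row PSt qS.
apply: ler_cvg_to (cvg_expected_cost PS cP) (cvg_expected_cost QS cQ) _.
by apply: filterS NP => t [_]; apply.
Qed.

End Limit.

(* A closed graph and a compact range: along an ultrafilter the minimizers
   converge, and their limit can only be the minimizer at the limit point. *)
Lemma cvg_the_Nash_minimizer (T : topologicalType) (F : set_system T)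
    (pi V : T -> 'rV[R]_d) (pi' V' : 'rV[R]_d) : Filter F ->
  (\forall t \near F, simplex (pi t)) -> simplex pi' ->
  pi @ F --> pi' -> V @ F --> V' ->
  the_Nash_minimizer c (pi t) (V t) @[t --> F] --> the_Nash_minimizer c pi' V'.
Proof.
move=> FF piS piS' cpi cV A nA; set P := fun t => the_Nash_minimizer c (pi t) (V t).
apply: contrapT => nFA.
(* If the minimizers did not eventually enter [A], then [F] restricted to where they avoid [A] would
   still be proper, and an ultrafilter refining it leads to a contradiction. *)
have FP : ProperFilter (within (~` (P @^-1` A)) F).
  split; last exact: within_filter.
  move=> h; apply: nFA; have {}h : F (fun t => ~ ~ A (P t)) := h.
  by rewrite /= nbhs_simpl; exact: (filterS (fun t nnA => contrapT nnA) h).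
have [G [GU FG]] := ultraFilterLemma FP.
have FsubG : F `<=` G by move=> B FB; apply: FG; exact: (filterS (fun t Bt _ => Bt) FB).
have piSG : \forall t \near G, simplex (pi t) by apply: FsubG.
have NP : \forall t \near G, Nash_minimizer c (pi t) (V t) (P t).
  by apply: filterS piSG => t /the_Nash_minimizerP.
have [P' cP] : exists P' : 'M[R]_d, P @ G --> P'.
  apply: (@ultra_mx_cvg R _ _ _ _ P 0 1); apply: filterS NP => t [PS _] i j.
  by rewrite stochastic_ge0 // stochastic_le1.
have NP' : Nash_minimizer c pi' V' P'.
  apply: cvg_Nash_minimizer piSG piS' _ _ _ _ NP cP.
    by apply: cvg_trans cpi; apply: cvg_app.
  by apply: cvg_trans cV; apply: cvg_app.
have GA : G (P @^-1` A).
  by apply: cP; rewrite (Nash_minimizer_uniq piS' NP').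
have GnA : G (~` (P @^-1` A)) by apply: FG; exact: withinT.
have : G (P @^-1` A `&` ~` (P @^-1` A)) by apply: filterI.
by rewrite setICr => /filter_not_empty.
Qed.

End NashContinuity.

(** * The invariant distribution and the ergodic equation from a fixed point *)

Theorem theorem3 (R : realType) (d : nat) (hd : (1 < d)%N) (c : costs R d)
  (hNash : forall pi V : 'rV[R]_d, simplex pi ->
     exists! P : 'M[R]_d, Nash_minimizer c pi V P)
  (hcont : forall i : 'I_d,
     {within (@simplex R d `*` @stochastic R d) `*` [set: 'rV[R]_d],
       continuous (fun x : 'rV[R]_d * 'M[R]_d * 'rV[R]_d =>
                     expected_cost c i x.1.1 x.1.2 x.2)})
  (hbound : exists C : R, forall pi V : 'rV[R]_d, simplex pi ->
     forall i i' : 'I_d, `|Nash_value c pi V i - Nash_value c pi V i'| <= C) :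
  exists (pi V : 'rV[R]_d) (lambda : R) (P : 'M[R]_d),
    [/\ simplex pi,
        Nash_minimizer c pi V P,
        P = the_Nash_minimizer c pi V,
        forall i : 'I_d,
          Nash_value c pi V i
            = \sum_(j < d) (c i j pi P * P i j + V ord0 j * P i j)
          /\ \sum_(j < d) (c i j pi P * P i j + V ord0 j * P i j)
            = V ord0 i + lambda
      & pi = pi *m P].
Proof.
(* The bound is enlarged to be strictly positive, since [g] divides by it. *)
have [C0 hC0] := hbound; pose C := `|C0| + 1.
have C_gt0 : 0 < C by rewrite ltr_wpDl.
have hC pi V : simplex pi -> forall i i',
    `|Nash_value c pi V i - Nash_value c pi V i'| <= C.
  move=> piS i i'; apply: le_trans (hC0 pi V piS i i') _.
  by rewrite (le_trans (ler_norm _)) // lerDl.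
have d_gt0 : 0 < d%:R :> R by rewrite ltr0n ltnW.
(* A point of the simplex in dimension [2 d] encodes [pi] in its first [d]
   coordinates, which are doubled and then retracted to the simplex, and [V] in
   the last [d] ones; [g] has both halves sum to [1 / 2]. *)
pose p (w : 'rV[R]_(d + d)) j := w ord0 (lshift d j).
pose q (w : 'rV[R]_(d + d)) j := w ord0 (rshift d j).
pose s w := 2 * \sum_j p w j.
(* Spreading the defect [|1 - s w|] uniformly keeps the total [D w] at least 1, even where [s w]
   vanishes; when [s w] is 1 the retraction leaves [2 * p w j] unchanged. *)
pose D w := s w + `|1 - s w|.
pose rpi w : 'rV[R]_d := \row_j ((2 * p w j + `|1 - s w| / d%:R) / D w).
(* The factor undoes the scaling in [g]: at a fixed point [rV w] is [G w] minus its mean, plus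
   [C]. *)
pose rV w : 'rV[R]_d := \row_j (2 * d%:R * C * q w j).
pose G w := Nash_value c (rpi w) (rV w).
pose P w := the_Nash_minimizer c (rpi w) (rV w).
(* The second half is nonnegative because each sum of differences is at most [d%:R * C] in absolute
   value, and it totals one half because those differences cancel in pairs. *)
pose g w : 'rV[R]_(d + d) := row_mx (\row_j ((rpi w *m P w) ord0 j / 2))
  (\row_j ((1 + (\sum_k (G w j - G w k)) / (d%:R * C)) / (2 * d%:R))).
have D_gt0 w : 0 < D w.
  rewrite /D; have := ler_norm (1 - s w); have [s0|s0] := leP (s w) 0; last lra.
  by rewrite ger0_norm; lra.
have rpiS w : simplex w -> simplex (rpi w).
  move=> [w0 _]; split=> [j|].
    by rewrite mxE divr_ge0 ?(ltW (D_gt0 w)) // addr_ge0 ?divr_ge0 ?mulr_ge0 ?w0.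
  under eq_bigr do rewrite mxE.
  rewrite -mulr_suml big_split /= -mulr_sumr sumr_const card_ord -/(s w).
  by rewrite -[_ / d%:R *+ d]mulr_natr divfK ?gt_eqF // -/(D w) divff ?gt_eqF.
have gS w : simplex w -> simplex (g w).
  move=> wS; have piS := rpiS w wS; have [NS _] := the_Nash_minimizerP hNash (rV w) piS.
  have [pP0 pP1] := simplex_mulmx piS NS.
  split=> [j|].
    rewrite mxE; case: splitP => k _; rewrite mxE.
      by rewrite divr_ge0.
    have : `|\sum_l (G w k - G w l)| <= d%:R * C.
      apply: le_trans (ler_norm_sum _ _ _) _.
      rewrite -[d in leRHS]card_ord mulr_natl -sumr_const.
      by apply: ler_sum => l _; apply: hC.
    rewrite ler_norml => /andP[Sk _].
    by rewrite divr_ge0 ?mulr_ge0 // -lerBlDl sub0r ler_pdivlMr ?mulr_gt0 // mulN1r.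
  rewrite big_split_ord /=.
  under eq_bigr do rewrite row_mxEl mxE.
  under [X in _ + X]eq_bigr do rewrite row_mxEr mxE.
  rewrite -!mulr_suml pP1 big_split /= -mulr_suml sumr_const card_ord.
  have -> : \sum_i \sum_k (G w i - G w k) = 0.
    by under eq_bigr do rewrite sumrB; rewrite sumrB exchange_big subrr.
  by field; rewrite !gt_eqF.
have gc : {within @simplex R (d + d), continuous g}.
  apply/subspace_continuousP => w wS.
  set F := within _ _; have FF : ProperFilter F.
    by split; [move=> /nbhs_singleton; apply | apply: within_filter].
  have FS : \forall w \near F, simplex w by apply: withinT.
  have cp j : p v j @[v --> F] --> p w j.
    by apply: cvg_within_filter; apply: coord_continuous.
  have cq j : q v j @[v --> F] --> q w j.
    by apply: cvg_within_filter; apply: coord_continuous.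
  have cs : s v @[v --> F] --> s w by apply: cvgM (cvg_cst _) (cvg_sumr _ cp).
  have cs' : `|1 - s v| @[v --> F] --> `|1 - s w| by apply: cvg_norm; apply: cvgB (cvg_cst _) cs.
  have cD : (D v)^-1 @[v --> F] --> (D w)^-1.
    by apply: cvgV; [rewrite gt_eqF | apply: cvgD].
  have cpi : rpi v @[v --> F] --> rpi w.
    apply: cvg_mx => i j; rewrite mxE; under eq_fun do rewrite mxE.
    apply: cvgM cD; apply: cvgD; first exact: cvgM (cvg_cst _) (cp j).
    exact: cvgM cs' (cvg_cst _).
  have cV : rV v @[v --> F] --> rV w.
    apply: cvg_mx => i j; rewrite mxE; under eq_fun do rewrite mxE.
    exact: cvgM (cvg_cst _) (cq j).
  have rpiSF : \forall v \near F, simplex (rpi v) by apply: filterS FS.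
  have cP : P v @[v --> F] --> P w.
    exact: (cvg_the_Nash_minimizer hNash hcont _ rpiSF (rpiS w wS) cpi cV).
  have cG i : G v i @[v --> F] --> G w i.
    apply: (cvg_expected_cost hcont rpiSF (rpiS w wS) cpi cV _ cP).
    by apply: filterS rpiSF => v /(the_Nash_minimizerP hNash (rV v))[].
  apply: cvg_mx => i j; case: (split_ordP j) => k ->.
    rewrite row_mxEl mxE; under eq_fun do rewrite row_mxEl mxE.
    apply: cvgM (cvg_cst _); rewrite mxE; under eq_fun do rewrite mxE.
    by apply: cvg_sumr => l; apply: cvgM; apply: cvg_entry.
  rewrite row_mxEr mxE; under eq_fun do rewrite row_mxEr mxE.
  apply: cvgM (cvg_cst _); apply: cvgD (cvg_cst _) _; apply: cvgM (cvg_cst _).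
  by apply: cvg_sumr => l; apply: cvgB.
have [w wS gw] := brouwer_simplex gS (lshift d (Ordinal (ltnW hd))) gc.
have piS := rpiS w wS; have NP := the_Nash_minimizerP hNash (rV w) piS.
have pE j : p w j = (rpi w *m P w) ord0 j / 2 by rewrite /p -{1}gw row_mxEl mxE.
have qE j : q w j = (1 + (\sum_k (G w j - G w k)) / (d%:R * C)) / (2 * d%:R).
  by rewrite /q -{1}gw row_mxEr mxE.
(* At the fixed point the first half sums to one half, so the retraction acts as plain doubling and
   [rpi w] is invariant under [P w]. *)
have sE : s w = 1.
  rewrite /s; under eq_bigr do rewrite pE.
  by rewrite -mulr_suml mulrC divfK // (simplex_mulmx piS NP.1).2.
(* The constant is the mean of [G w] less the shift [C] built into [rV w]. *)
exists (rpi w), (rV w), ((\sum_k G w k) / d%:R - C), (P w); split => //.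
  move=> i; split => //; rewrite -[LHS]/(G w i) mxE qE sumrB sumr_const card_ord -mulr_natr.
  by field; rewrite !gt_eqF.
apply/rowP => j; rewrite {1}/rpi mxE pE /D sE subrr normr0 mul0r !addr0 divr1.
by rewrite mulrC divfK.
Qed.
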